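(* Let $n\ge 1$ and $\lambda>0$, and let $\sigma:\mathbb{R}^n\to\mathbb{R}^n$, $\sigma_i(z) = \frac{\exp(\lambda z_i)}{\sum_{j=1}^n\exp(\lambda z_j)}$ for $1\le i\le n$, be the softmax function with inverse temperature constant $\lambda$. Then $\sigma$ is $L$-Lipschitz with respect to $\|\cdot\|_2$ with $L=\lambda$, that is, for all $z,z'\in\mathbb{R}^n$, $$\|\sigma(z)-\sigma(z')\|_2\le\lambda\|z-z'\|_2.$$
   Context: $\|\cdot\|_2$ denotes the Euclidean norm on $\mathbb{R}^n$. *)

(* Defs.v *)
From mathcomp Require Import all_boot all_order all_algebra.
From mathcomp Require Import all_classical all_reals all_analysis.

Set Implicit Arguments.
Unset Strict Implicit.
Unset Printing Implicit Defensive.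

Import Order.TTheory GRing.Theory Num.Theory.
Local Open Scope ring_scope.

(* The norm `|x| that MathComp-Analysis puts on 'rV[R]_n is the max norm, so
   the Euclidean norm has to be defined separately. *)
Definition norm2 (R : realType) (n : nat) (x : 'rV[R]_n) : R :=
  Num.sqrt (\sum_(i < n) x 0 i ^+ 2).

Definition softmax (R : realType) (n : nat) (lambda : R) (z : 'rV[R]_n) :
    'rV[R]_n :=
  \row_(i < n) (expR (lambda * z 0 i) / \sum_(j < n) expR (lambda * z 0 j)).

(* Main.v *)
Require Import Defs.
From mathcomp Require Import all_boot all_order all_algebra.
From mathcomp Require Import all_classical all_reals all_analysis.
From mathcomp Require Import ring lra.

Import Order.TTheory GRing.Theory Num.Theory.
Local Open Scope ring_scope.

(** The proof avoids differentiating the softmax.  Write p = softmax z and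
    q = softmax z'.  Normalisation is a shift in the exponent: with the
    log-partition function F, ln p_i = lambda z_i - F(z), so

      ln p_i - ln q_i = lambda (z_i - z'_i) - c,   c = F(z) - F(z'),

    where c does not depend on i.  Since p_i, q_i lie in (0, 1], where ln has
    slope at least 1 ([sqr_expRB_le], stated through exp),

      (p_i - q_i)^2 <= (p_i - q_i) (ln p_i - ln q_i).

    Summing over i, the constant c disappears because p and q both sum to 1
    ([sum_softmax]), which leaves ||p - q||^2 <= lambda <p - q, z - z'>.
    Expanding 0 <= ||lambda (z - z') - (p - q)||^2 turns this into
    ||p - q||^2 <= lambda^2 ||z - z'||^2. *)

(** By symmetry v <= u; then exp(v - u) >= 1 + (v - u), multiplied by exp u,
    gives exp u - exp v <= exp u (u - v), and exp u <= 1. *)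
Lemma sqr_expRB_le (R : realType) (u v : R) : u <= 0 -> v <= 0 ->
  (expR u - expR v) ^+ 2 <= (expR u - expR v) * (u - v).
Proof.
wlog vu : u v / v <= u => [hw u0 v0|u0 _].
  have [vu|/ltW uv] := leP v u; first exact: hw.
  have := hw _ _ uv v0 u0; lra.
have e1 : expR u <= 1 by rewrite -expR0 ler_expR.
have ev : expR v = expR u * expR (v - u) by rewrite -expRD addrC subrK.
rewrite expr2; apply: ler_wpM2l; first by rewrite subr_ge0 ler_expR.
have := expR_ge1Dx (v - u); have := expR_gt0 u.
rewrite ev; nra.
Qed.

Definition partition_fun {R : realType} {n : nat} (lambda : R)
    (z : 'rV[R]_n) : R := \sum_(j < n) expR (lambda * z 0 j).

Lemma partition_fun_gt0 (R : realType) (n : nat) (lambda : R)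
  (z : 'rV[R]_n) : (0 < n)%N -> 0 < partition_fun lambda z.
Proof.
case: n z => // n z _; rewrite /partition_fun big_ord_recl ltr_pwDl ?expR_gt0//.
by apply: sumr_ge0 => j _; exact: expR_ge0.
Qed.

Lemma sum_softmax (R : realType) (n : nat) (lambda : R) (z : 'rV[R]_n) :
  (0 < n)%N -> \sum_(i < n) softmax lambda z 0 i = 1.
Proof.
move=> n0; under eq_bigr do rewrite mxE.
by rewrite -mulr_suml divff// gt_eqF// partition_fun_gt0.
Qed.

Lemma softmaxE (R : realType) (n : nat) (lambda : R) (z : 'rV[R]_n) i :
  (0 < n)%N ->
  softmax lambda z 0 i = expR (lambda * z 0 i - ln (partition_fun lambda z)).
Proof.
by move=> n0; rewrite mxE expRB lnK// posrE partition_fun_gt0.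
Qed.

(** Each term exp(lambda z_i) is at most the sum of all of them. *)
Lemma log_softmax_le0 (R : realType) (n : nat) (lambda : R)
  (z : 'rV[R]_n) i : (0 < n)%N ->
  lambda * z 0 i - ln (partition_fun lambda z) <= 0.
Proof.
move=> n0; rewrite -ler_expR expR0 -softmaxE// -(sum_softmax _ _ lambda z n0).
rewrite (bigD1 i)//= lerDl; apply: sumr_ge0 => j _.
by rewrite softmaxE// expR_ge0.
Qed.

Theorem proposition4 (R : realType) (n : nat) (hn : (1 <= n)%N)
    (lambda : R) (hlambda : 0 < lambda) (z z' : 'rV[R]_n) :
  norm2 (softmax lambda z - softmax lambda z') <= lambda * norm2 (z - z').
Proof.
pose c := ln (partition_fun lambda z) - ln (partition_fun lambda z').
pose d i := softmax lambda z 0 i - softmax lambda z' 0 i.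
have dc0 : \sum_(i < n) 2 * (d i * c) = 0.
  by rewrite -mulr_sumr -mulr_suml sumrB !sum_softmax// subrr mul0r mulr0.
(* The quadratic expansion, done coordinatewise: its cross term is bounded by
   the slope inequality, up to the multiple of c whose sum is zero. *)
have step i : d i ^+ 2 + 2 * (d i * c) <= lambda ^+ 2 * (z 0 i - z' 0 i) ^+ 2.
  have := sqr_expRB_le _ _ _ (log_softmax_le0 _ _ lambda z i hn)
                             (log_softmax_le0 _ _ lambda z' i hn).
  rewrite -!softmaxE// -/(d i).
  have := sqr_ge0 (lambda * (z 0 i - z' 0 i) - d i).
  rewrite /c; lra.
have sum_le : \sum_(i < n) d i ^+ 2 <=
    lambda ^+ 2 * \sum_(i < n) (z 0 i - z' 0 i) ^+ 2.
  rewrite -[leLHS]addr0 -[X in _ + X <= _]dc0 -big_split mulr_sumr.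
  by apply: ler_sum => i _; exact: step.
rewrite /norm2 -[X in X * _](ger0_norm (ltW hlambda)) -sqrtr_sqr -sqrtrM ?sqr_ge0//.
apply: ler_wsqrtr.
under eq_bigr do rewrite [_ 0 _]mxE [X in _ + X]mxE.
by under [X in _ <= _ * X]eq_bigr do rewrite [_ 0 _]mxE [X in _ + X]mxE.
Qed.
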